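(* Let $E$ be either $c_0$ or $L_1$, and let $Y$ be a Banach space such that $Y^*$ is separable. Then there is no weak-to-weak$^*$ sequentially continuous map $f:E\to Y^*$ which is a coarse embedding, and there is no weak-to-weak$^*$ sequentially continuous map $f:E\to Y^*$ which is a uniform embedding.
   Context: $L_1=L_1[0,1]$. For a map $f:(M,d_M)\to(N,d_N)$ between metric spaces and $t\ge0$, let $\rho_f(t)=\inf\{d_N(f(x),f(y)): d_M(x,y)\ge t\}$ and $\omega_f(t)=\sup\{d_N(f(x),f(y)): d_M(x,y)\le t\}$ (with $\inf\emptyset=\infty$, $\sup\emptyset=0$). The map $f$ is a coarse embedding if $\lim_{t\to\infty}\rho_f(t)=\infty$ and $\omega_f(t)<\infty$ for all $t\in[0,\infty)$. The map $f$ is a uniform embedding if it is injective, uniformly continuous, and its inverse $f^{-1}:f(M)\to M$ is uniformly continuous. Here Banach spaces carry their norm metrics. A map $f:E\to Y^*$ is weak-to-weak$^*$ sequentially continuous if $f(x_n)\to f(x)$ in the weak$^*$ topology $\sigma(Y^*,Y)$ whenever $x_n\to x$ weakly in $E$. *)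

(* Defs.v *)
From HB Require Import structures.
From mathcomp Require Import all_boot all_order all_algebra.
From mathcomp Require Import all_classical all_reals all_analysis.
From mathcomp Require Import measurable_realfun.

Set Implicit Arguments.
Unset Strict Implicit.
Unset Printing Implicit Defensive.
Import Order.TTheory GRing.Theory Num.Theory.
Import numFieldNormedType.Exports.
Local Open Scope classical_set_scope.
Local Open Scope ring_scope.

Section Dual.
Variables (R : realType) (V : normedModType R).

Definition dual_pred : {pred V -> R^o} :=
  mem [set f : V -> R^o | linear f /\ continuous f].

Lemma dual_submod_closed : submod_closed dual_pred.
Proof.
split; first rewrite inE /=; first split.
- by move=> a u v /=; rewrite scaler0 addr0.
- exact: cst_continuous.
- move=> a f g; rewrite !inE /= => -[lf cf] [lg cg]; split.
    move=> k u v; change (a *: f (k *: u + v) + g (k *: u + v) =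
      k *: (a *: f u + g u) + (a *: f v + g v)).
    by rewrite lf lg !scalerDr !scalerA [a * k]mulrC addrACA.
  move=> x; apply: (@cvgD _ _ _ _ _ (a \*: f) g); last exact: cg.
  by apply: cvgZr; exact: cf.
Qed.

HB.instance Definition _ := GRing.isSubmodClosed.Build R (V -> R^o) dual_pred
  dual_submod_closed.

Record dual := Dual { dual_fun :> V -> R^o ; dual_funP : dual_fun \in dual_pred }.

HB.instance Definition _ := [isSub for dual_fun].
HB.instance Definition _ := [Choice of dual by <:].
HB.instance Definition _ := [SubChoice_isSubLmodule of dual by <:].

Lemma dual_linear (f : dual) : linear f.
Proof. by have := dual_funP f; rewrite inE => -[]. Qed.

Lemma dual_continuous (f : dual) : continuous f.
Proof. by have := dual_funP f; rewrite inE => -[]. Qed.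

Definition dual_norm (f : dual) : R :=
  sup [set `|f x| | x in [set x : V | `|x| <= 1]].

Lemma dual_has_sup (f : dual) :
  has_sup [set `|f x| | x in [set x : V | `|x| <= 1]].
Proof.
pose f' := GRing.isLinear.Build R V R^o _ f (dual_linear f).
pose F : {linear V -> R^o} := HB.pack (f : V -> R^o) f'.
split; first by exists `|f 0|, 0 => //=; rewrite normr0.
have /linear_bounded_continuous/bounded_funP/(_ 1)[M hM] : continuous F.
  exact: dual_continuous.
by exists M => _ [x /= x1 <-]; exact: hM.
Qed.

Lemma dual_norm_ub (f : dual) x : `|x| <= 1 -> `|f x| <= dual_norm f.
Proof.
move=> x1; apply: ub_le_sup; first by case: (dual_has_sup f).
by exists x.
Qed.

Lemma dual_normD (f g : dual) : dual_norm (f + g) <= dual_norm f + dual_norm g.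
Proof.
apply: ge_sup; first by case: (dual_has_sup (f + g)).
move=> _ [x /= x1 <-]; rewrite (le_trans (ler_normD (f x) (g x)))//.
by rewrite lerD// dual_norm_ub.
Qed.

Lemma dual_normZ_le a (f : dual) : dual_norm (a *: f) <= `|a| * dual_norm f.
Proof.
apply: ge_sup; first by case: (dual_has_sup (a *: f)).
move=> _ [x /= x1 <-]; change (`|a *: f x| <= `|a| * dual_norm f).
by rewrite normrZ ler_wpM2l// dual_norm_ub.
Qed.

Lemma dual_normZ a (f : dual) : dual_norm (a *: f) = `|a| * dual_norm f.
Proof.
apply/eqP; rewrite eq_le dual_normZ_le /=.
have [->|a0] := eqVneq a 0.
  rewrite normr0 mul0r (le_trans _ (dual_norm_ub _ (x := 0) _))//.
  by rewrite normr0.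
rewrite -ler_pdivlMl ?normr_gt0// -normfV.
by rewrite (le_trans _ (dual_normZ_le _ _))// scalerA mulVf// scale1r.
Qed.

Lemma dual_norm_eq0 (f : dual) : dual_norm f = 0 -> f = 0.
Proof.
move=> f0; apply/val_inj/funext => x /=; change (f x = 0).
have [->|x0] := eqVneq x 0.
  by have := dual_linear f (-1) 0 0; rewrite scaler0 addr0 scaleN1r addNr.
have : `|f (`|x|^-1 *: x)| <= 0.
  by rewrite -f0; apply: dual_norm_ub; rewrite normfZV.
rewrite normr_le0 => /eqP.
have := dual_linear f (`|x|^-1) x 0; rewrite addr0 => ->.
have -> : f 0 = 0.
  by have := dual_linear f (-1) 0 0; rewrite scaler0 addr0 scaleN1r addNr.
rewrite addr0 => /eqP; rewrite scaler_eq0 invr_eq0 normr_eq0 (negbTE x0) /=.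
by move/eqP.
Qed.

HB.instance Definition _ := Lmodule_isNormed.Build R dual
  dual_normD dual_normZ dual_norm_eq0.

End Dual.

Section C0.
Variable R : realType.

Definition c0_pred : {pred nat -> R^o} :=
  mem [set u : nat -> R^o | u n @[n --> \oo] --> (0 : R^o)].

Lemma c0_submod_closed : submod_closed c0_pred.
Proof.
split; first by rewrite inE /=; exact: cvg_cst.
move=> a u v; rewrite !inE /= => u0 v0.
have := @cvgD _ _ _ _ _ (a \*: u) v _ _ (cvgZr u0) v0.
by rewrite scaler0 addr0; exact.
Qed.

HB.instance Definition _ := GRing.isSubmodClosed.Build R (nat -> R^o) c0_pred
  c0_submod_closed.

Record c0 := C0 { c0_seq :> nat -> R^o ; c0_seqP : c0_seq \in c0_pred }.

HB.instance Definition _ := [isSub for c0_seq].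
HB.instance Definition _ := [Choice of c0 by <:].
HB.instance Definition _ := [SubChoice_isSubLmodule of c0 by <:].

Definition c0_norm (u : c0) : R := sup (range (fun n => `|u n|)).

Lemma c0_has_sup (u : c0) : has_sup (range (fun n => `|u n|)).
Proof.
split; first by exists `|u 0%N|, 0%N.
have cu : cvgn (u : nat -> R^o).
  by apply/cvg_ex; exists 0; have := c0_seqP u; rewrite inE.
have [M [Mr hM]] := cvg_seq_bounded cu.
exists (M + 1) => _ [n _ <-].
by apply: hM => //; rewrite ltrDl.
Qed.

Lemma c0_norm_ub (u : c0) n : `|u n| <= c0_norm u.
Proof.
apply: ub_le_sup; first by case: (c0_has_sup u).
by exists n.
Qed.

Lemma c0_normD (u v : c0) : c0_norm (u + v) <= c0_norm u + c0_norm v.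
Proof.
apply: ge_sup; first by case: (c0_has_sup (u + v)).
move=> _ [n _ <-]; rewrite (le_trans (ler_normD (u n) (v n)))//.
by rewrite lerD// c0_norm_ub.
Qed.

Lemma c0_normZ_le a (u : c0) : c0_norm (a *: u) <= `|a| * c0_norm u.
Proof.
apply: ge_sup; first by case: (c0_has_sup (a *: u)).
move=> _ [n _ <-]; change (`|a *: u n| <= `|a| * c0_norm u).
by rewrite normrZ ler_wpM2l// c0_norm_ub.
Qed.

Lemma c0_normZ a (u : c0) : c0_norm (a *: u) = `|a| * c0_norm u.
Proof.
apply/eqP; rewrite eq_le c0_normZ_le /=.
have [->|a0] := eqVneq a 0.
  by rewrite normr0 mul0r (le_trans _ (c0_norm_ub _ 0%N)).
rewrite -ler_pdivlMl ?normr_gt0// -normfV.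
by rewrite (le_trans _ (c0_normZ_le _ _))// scalerA mulVf// scale1r.
Qed.

Lemma c0_norm_eq0 (u : c0) : c0_norm u = 0 -> u = 0.
Proof.
move=> u0; apply/val_inj/funext => n /=; change (u n = 0).
by apply/eqP; rewrite -normr_le0 -u0 c0_norm_ub.
Qed.

HB.instance Definition _ := Lmodule_isNormed.Build R c0
  c0_normD c0_normZ c0_norm_eq0.

End C0.

Section L1.
Context d (T : measurableType d) (R : realType).
Variable mu : {measure set T -> \bar R}.
Local Open Scope quotient_scope.

Local Notation L1 := (LspaceType1 mu).
Local Notation F := (LfunType mu (@lexx _ _ 1%E)).
Local Notation Q := ({mfun_ mu, T >-> measurableTypeR R}).

HB.instance Definition _ := gen_eqMixin L1.
HB.instance Definition _ := gen_choiceMixin L1.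

Lemma eq_Lnorm1 (f g : {mfun T >-> R}) : (f : T -> R) = g %[ae mu] ->
  ('N[mu]_1[EFin \o f] = 'N[mu]_1[EFin \o g])%E.
Proof.
move=> fg; rewrite !Lnorm1.
have mabs (h : {mfun T >-> R}) :
    measurable_fun [set: T] (abse \o (EFin \o h)).
  apply/measurableT_comp; first exact: abse_measurable.
  have mh : measurable_fun [set: T] h by [].
  exact/measurable_EFinP.
apply: ge0_ae_eq_integral; [exact: measurableT|exact: mabs|exact: mabs| | |];
  do ?by move=> x _; exact: abse_ge0.
by move: fg; apply: filterS => x fg xT /=; rewrite fg.
Qed.

(* [R] and [measurableTypeR R] carry the same sigma-algebra under different
   displays, so that [{mfun T >-> R}] and [{mfun T >-> measurableTypeR R}],
   on which [LspaceType] is based, are not convertible. *)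
Definition mfunR (f : {mfun T >-> R}) : {mfun T >-> measurableTypeR R} :=
  HB.pack_for {mfun T >-> measurableTypeR R} (f : T -> measurableTypeR R)
    (isMeasurableFun.Build d _ T (measurableTypeR R) f
       (measurable_funPT f : measurable_fun [set: T] f)).

Local Notation cls f := (\pi_Q (mfunR f)).

Lemma repr_ae (f : {mfun T >-> R}) : (repr (cls f) : T -> R) = f %[ae mu].
Proof.
have /eqP := reprK (cls f).
by rewrite eqmodE => /asboolP.
Qed.

Lemma L1_repr_Lfun (x : L1) : (repr (x : Q) : T -> R) \in Lfun mu 1.
Proof.
rewrite inE; apply/andP; split; rewrite inE /=.
  exact: (measurable_funPT (repr (x : Q))).
exact: Lebesgue_finite.
Qed.

Lemma L1_class_finite (f : F) : finite_norm mu 1 (repr (cls f) : T -> R).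
Proof.
have mr : measurable_fun [set: T] (repr (cls f) : T -> R).
  exact: (measurable_funPT (repr (cls f))).
pose g : {mfun T >-> R} := HB.pack_for {mfun T >-> R} (repr (cls f) : T -> R)
  (isMeasurableFun.Build d _ T R (repr (cls f) : T -> R) mr).
rewrite /finite_norm -[repr (cls f) : T -> R]/(g : T -> R).
rewrite (@eq_Lnorm1 g f (repr_ae f)); exact: Lfunction_finite.
Qed.

Definition L1_class (f : F) : L1 :=
  HB.pack_for L1 (cls f)
    (isFinLebesgue.Build d T R mu 1%E (@lexx _ _ 1%E) (cls f)
       (L1_class_finite f)).

Definition L1_repr (x : L1) : F := Lfun_Sub (@lexx _ _ 1%E) (L1_repr_Lfun x).

Lemma L1_class_eq (f g : F) :
  (f : T -> R) = g %[ae mu] -> L1_class f = L1_class g.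
Proof.
move=> fg.
have fgQ : cls f = cls g by apply/eqP; rewrite eqmodE; exact/asboolP.
rewrite /L1_class.
move: (L1_class_finite f) (L1_class_finite g); rewrite fgQ => p q.
by rewrite (Prop_irrelevance p q).
Qed.

Lemma L1_repr_class (f : F) : (L1_repr (L1_class f) : T -> R) = f %[ae mu].
Proof. exact: repr_ae. Qed.

Lemma L1_reprK (x : L1) : L1_class (L1_repr x) = x.
Proof.
rewrite /L1_class; move: (L1_class_finite _) => p.
have : cls (L1_repr x) = x :> Q.
  rewrite -[RHS]reprK; apply/eqP; rewrite eqmodE; apply/asboolP.
  exact: ae_eq_refl.
case: x p => x [[fx]] p /= e.
move: p; rewrite e => p.
by rewrite (Prop_irrelevance p fx).
Qed.

Definition L1_zero : L1 := L1_class 0.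
Definition L1_opp (x : L1) : L1 := L1_class (- L1_repr x).
Definition L1_add (x y : L1) : L1 := L1_class (L1_repr x + L1_repr y).
Definition L1_scale (a : R) (x : L1) : L1 := L1_class (a *: L1_repr x).
Definition L1_norm (x : L1) : R := fine ('N[mu]_1[EFin \o L1_repr x])%E.

Lemma L1_addE (f g : F) : L1_add (L1_class f) (L1_class g) = L1_class (f + g).
Proof.
apply: L1_class_eq.
have := L1_repr_class g; have := L1_repr_class f.
apply: filterS2 => t /= ft gt tT.
by change (L1_repr (L1_class f) t + L1_repr (L1_class g) t = f t + g t);
  rewrite ft// gt.
Qed.

Lemma L1_oppE (f : F) : L1_opp (L1_class f) = L1_class (- f).
Proof.
apply: L1_class_eq.
have := L1_repr_class f; apply: filterS => t /= ft tT.
by change (- L1_repr (L1_class f) t = - f t); rewrite ft.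
Qed.

Lemma L1_scaleE a (f : F) : L1_scale a (L1_class f) = L1_class (a *: f).
Proof.
apply: L1_class_eq.
have := L1_repr_class f; apply: filterS => t /= ft tT.
by change (a *: L1_repr (L1_class f) t = a *: f t); rewrite ft.
Qed.

Lemma L1_normE (f : F) : L1_norm (L1_class f) = fine ('N[mu]_1[EFin \o f])%E.
Proof. by rewrite /L1_norm (eq_Lnorm1 (L1_repr_class f)). Qed.

Lemma L1_addA : associative L1_add.
Proof.
move=> x y z; rewrite -(L1_reprK x) -(L1_reprK y) -(L1_reprK z).
by rewrite !L1_addE addrA.
Qed.

Lemma L1_addC : commutative L1_add.
Proof. by move=> x y; rewrite /L1_add addrC. Qed.

Lemma L1_add0 : left_id L1_zero L1_add.
Proof. by move=> x; rewrite -(L1_reprK x) L1_addE add0r. Qed.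

Lemma L1_addN : left_inverse L1_zero L1_opp L1_add.
Proof. by move=> x; rewrite -(L1_reprK x) L1_oppE L1_addE addNr. Qed.

HB.instance Definition _ := GRing.isZmodule.Build L1
  L1_addA L1_addC L1_add0 L1_addN.

Lemma L1_scaleA a b (x : L1) : L1_scale a (L1_scale b x) = L1_scale (a * b) x.
Proof. by rewrite -(L1_reprK x) !L1_scaleE scalerA. Qed.

Lemma L1_scale1 : left_id 1 L1_scale.
Proof. by move=> x; rewrite -(L1_reprK x) L1_scaleE scale1r. Qed.

Lemma L1_scaleDr : right_distributive L1_scale +%R.
Proof.
move=> a x y; change (L1_scale a (L1_add x y) =
  L1_add (L1_scale a x) (L1_scale a y)).
by rewrite -(L1_reprK x) -(L1_reprK y) !(L1_addE, L1_scaleE) scalerDr.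
Qed.

Lemma L1_scaleDl (x : L1) : {morph L1_scale^~ x : a b / a + b}.
Proof.
move=> a b; change (L1_scale (a + b) x = L1_add (L1_scale a x) (L1_scale b x)).
by rewrite -(L1_reprK x) !(L1_addE, L1_scaleE) scalerDl.
Qed.

HB.instance Definition _ := GRing.Zmodule_isLmodule.Build R L1
  L1_scaleA L1_scale1 L1_scaleDr L1_scaleDl.

Lemma L1_normD (x y : L1) : L1_norm (x + y) <= L1_norm x + L1_norm y.
Proof. by rewrite [x + y]/(L1_class _) L1_normE; exact: ler_LnormD. Qed.

Lemma L1_normZ a (x : L1) : L1_norm (a *: x) = `|a| * L1_norm x.
Proof.
rewrite [a *: x]/(L1_class _) L1_normE /L1_norm.
by apply: EFin_inj; rewrite EFinM !finite_norm_fine LnormZ.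
Qed.

Lemma L1_norm_eq0 (x : L1) : L1_norm x = 0 -> x = 0.
Proof.
move=> /fine_Lnormr_eq0 x0; rewrite -(L1_reprK x).
exact: L1_class_eq.
Qed.

HB.instance Definition _ := Lmodule_isNormed.Build R L1
  L1_normD L1_normZ L1_norm_eq0.

End L1.

Section WeakTopologies.
Variables (R : realType) (V : normedModType R).

Definition weak := initial_topology
  ((fun x phi => phi x) : V -> {ptws dual V -> R^o}).
HB.instance Definition _ := Topological.on weak.

Definition weak_star := initial_topology
  (@dual_fun R V : dual V -> {ptws V -> R^o}).
HB.instance Definition _ := Topological.on weak_star.

End WeakTopologies.

Lemma cvg_initial (S : choiceType) (T : topologicalType) (h : S -> T)
    (F : set_system S) (s : S) : Filter F ->
  (F --> (s : initial_topology h)) <-> (h @ F --> h s).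
Proof.
move=> FF; split=> [Fs|Fs A].
  exact: (cvg_comp _ _ Fs (@initial_continuous _ _ h s)).
rewrite nbhsE => -[_ [[B oB <-] Bs] BA].
by apply: (filterS BA); apply: Fs; exact: open_nbhs_nbhs.
Qed.

Lemma weak_cvgP (R : realType) (V : normedModType R) (F : set_system V) (x : V) :
  Filter F -> (F --> (x : weak V)) <->
  (forall phi : dual V, phi y @[y --> F] --> phi x).
Proof.
by move=> FF; rewrite cvg_initial; exact: pointwise_cvgP.
Qed.

Lemma weak_star_cvgP (R : realType) (V : normedModType R)
    (F : set_system (dual V)) (phi : dual V) :
  Filter F -> (F --> (phi : weak_star V)) <->
  (forall x : V, psi x @[psi --> F] --> phi x).
Proof.
by move=> FF; rewrite cvg_initial; exact: pointwise_cvgP.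
Qed.

Definition weak_to_weak_star_seq_continuous (R : realType)
    (E Y : normedModType R) (f : E -> dual Y) : Prop :=
  forall (u : nat -> E) (x : E),
    u n @[n --> \oo] --> (x : weak E) ->
    f (u n) @[n --> \oo] --> (f x : weak_star Y).

Section Embeddings.
Variables (R : realType) (E F : normedModType R) (f : E -> F).
Local Open Scope ereal_scope.

Definition rho (t : R) : \bar R :=
  ereal_inf [set `|f p.1 - f p.2|%:E |
             p in [set p : E * E | (t <= `|p.1 - p.2|)%R]].

(* The point 0 implements the convention that the supremum of the empty set
   is 0, whereas [ereal_sup set0 = -oo]. *)
Definition omega (t : R) : \bar R :=
  ereal_sup (0 |` [set `|f p.1 - f p.2|%:E |
                    p in [set p : E * E | (`|p.1 - p.2| <= t)%R]]).

Definition coarse_embedding : Prop :=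
  (rho t @[t --> +oo%R] --> +oo) /\ (forall t : R, (0 <= t)%R -> omega t < +oo).

Definition uniform_embedding : Prop :=
  [/\ injective f,
      unif_continuous f &
      exists2 g : range f -> E,
        (forall y : range f, f (g y) = set_val y) & unif_continuous g].

End Embeddings.

Definition separable (T : topologicalType) : Prop :=
  exists2 A : set T, countable A & dense A.

(* Functions on [0, 1] are represented by functions on the whole real line,
   identified when they agree almost everywhere on [0, 1]. *)
Definition lebesgue01 (R : realType) :
    {measure set (measurableTypeR R) -> \bar R} :=
  mrestr (@lebesgue_measure R) (measurable_itv `[0%R, 1%R]).

Definition L1_01 (R : realType) : normedModType R :=
  LspaceType1 (lebesgue01 R).

(* Main.v *)
From HB Require Import structures.
Require Import Defs.
From mathcomp Require Import all_boot all_order all_algebra.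
From mathcomp Require Import all_classical all_reals all_analysis.
From mathcomp Require Import measurable_realfun ring lra.

Set Implicit Arguments.
Unset Strict Implicit.
Unset Printing Implicit Defensive.
Import Order.TTheory GRing.Theory Num.Theory.
Import numFieldNormedType.Exports.
Local Open Scope classical_set_scope.
Local Open Scope ring_scope.

(** Both parts rest on the failure, in [c0] and in [L1], of a point of
continuity property that every separable dual enjoys.

In a separable dual, a norm-bounded nonempty set [T] contains a functional that
is not the weak-star limit of a sequence from [T] staying at a fixed distance
[e] from it ([norm_gap_not_separable]). This is the Baire-category fact that
the identity of a weak-star compact subset of a separable dual has points of
weak-star-to-norm continuity, in a sequential form. If all points of [T]
were such limits, one could pass step by step to smaller and smaller weak-star
open sets meeting [T], the k-th one staying at distance [e / 3] from the k-th
member of a dense sequence, because one of two points of [T] at mutual distance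
[e] always does. By weak-star compactness the choices accumulate at a
functional, which is then far from the whole dense sequence.

A set [S] in a normed space is called weakly spread below if it is bounded and
each of its points is the weak limit of a sequence of [S] that stays at
distance at least [d] from it. A weak-to-weak-star sequentially continuous map
sends such a set to a set with the forbidden norm gap as soon as the map is
bounded on [S] and keeps points at distance [d] uniformly apart. A uniform
embedding does so: it is Lipschitz for large distances, hence bounded on balls,
and its inverse is uniformly continuous. A coarse embedding does so once [S] is
replaced by a large multiple ([weakly_spread_no_embedding]). Hence it suffices
to find a weakly spread set in each space.

In [c0] the indicators of finite sets form one ([c0_weakly_spread]): adding the
n-th unit vector to such an indicator moves it by 1, and the unit vectors are
weakly null. In [L1] one takes the bounded densities [w >= 0] of mass strictly
between 1 and 3 ([L1_weakly_spread]), and multiplies [w] by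
[1 + cos (2 * pi * n * x)]: the increments are weakly null, and their norms are
at least the integrals of [w * cos ^ 2], which tend to half the mass of [w].

Weak nullity is obtained in both spaces without describing the dual space, from
an upper 2-estimate on linear combinations ([weakly_null_of_2_estimate]): an
obvious bound in [c0], and Bessel's inequality in [L1]. *)

(** * Functionals and norms *)

Lemma dualD (R : realType) (V : normedModType R) (f : dual V) u v :
  f (u + v) = f u + f v.
Proof. by have := dual_linear f 1 u v; rewrite !scale1r. Qed.

Lemma dual0 (R : realType) (V : normedModType R) (f : dual V) : f 0 = 0.
Proof. by apply: (addrI (f 0)); rewrite -dualD !addr0. Qed.

Lemma dualZ (R : realType) (V : normedModType R) (f : dual V) (a : R) v :
  f (a *: v) = a * f v :> R.
Proof. by have := dual_linear f a v 0; rewrite !addr0 dual0 addr0. Qed.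

Lemma dual_sum (R : realType) (V : normedModType R) (f : dual V) N
  (g : nat -> V) : f (\sum_(n < N) g n) = \sum_(n < N) f (g n).
Proof. exact: (big_morph f (dualD f) (dual0 f)). Qed.

Lemma dual_norm_le (R : realType) (V : normedModType R) (f : dual V) v :
  `|f v| <= `|f| * `|v|.
Proof.
have [->|v0] := eqVneq v 0; first by rewrite dual0 !normr0 mulr0.
have nv : 0 < `|v| by rewrite normr_gt0.
have /dual_norm_ub : `| `|v|^-1 *: v| <= 1 by rewrite normfZV.
move=> /(_ f); rewrite dualZ normrM normfV normr_id -ler_pdivlMl ?invr_gt0//.
by rewrite invrK mulrC.
Qed.

Lemma dual_norm_gtP (R : realType) (V : normedModType R) (f : dual V) (e : R) :
  e < `|f| -> exists2 v, `|v| <= 1 & e < `|f v|.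
Proof.
move=> ef; apply: contrapT => nex; move: ef; rewrite ltNge => /negP; apply.
apply: ge_sup; first by case: (dual_has_sup f).
move=> _ [v /= v1 <-]; rewrite leNgt; apply/negP => ev.
by apply: nex; exists v.
Qed.

Lemma dual_of_bounded_linear (R : realType) (V : normedModType R)
    (f : V -> R^o) (C : R) :
  linear f -> (forall v, `|f v| <= C * `|v|) ->
  {g : dual V | g = f :> (V -> R^o)}.
Proof.
move=> lf fC.
have cf : continuous f.
  pose f' := GRing.isLinear.Build R V R^o _ f lf.
  pose F : {linear V -> R^o} := HB.pack f f'.
  apply: (@bounded_linear_continuous _ _ _ F); apply/bounded_funP => r.
  exists (`|C| * `|r|) => v vr; rewrite (le_trans (fC v))//.
  rewrite (le_trans (ler_wpM2r (normr_ge0 _) (ler_norm C)))//.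
  by rewrite ler_wpM2l// (le_trans vr)// ler_norm.
have fP : f \in @dual_pred R V by rewrite inE.
by exists (Dual fP).
Qed.

(** * Weak-star limits in a separable dual *)

(** A filter form of the Banach--Alaoglu theorem: along an ultrafilter refining
    [F], the values at each [v] converge, since they stay in a segment, and the
    norm bound passes to the limit. *)
Lemma bounded_weak_star_limit (R : realType) (V : normedModType R)
    (F : set_system (dual V)) (M : R) :
  ProperFilter F -> F [set f | `|f| <= M] ->
  exists G : set_system (dual V), [/\ ProperFilter G, F `<=` G &
    exists g : dual V, forall v, (fun f : dual V => f v : R) @ G --> (g v : R)].
Proof.
move=> PF FM; have [G [UG FG]] := ultraFilterLemma PF.
exists G; split => //; first exact: ultra_proper.
have PG : ProperFilter G by exact: ultra_proper.
have GM : G [set f | `|f| <= M] by exact: FG.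
have lim v : exists l : R, (fun f : dual V => (f v : R)) @ G --> l.
  pose ev := fun f : dual V => (f v : R).
  have evM : G (ev @^-1` [set` `[- (M * `|v|), M * `|v|]]).
    apply: filterS GM => f /= fM; rewrite in_itv/= -ler_norml.
    by rewrite (le_trans (dual_norm_le f v))// ler_wpM2r.
  have [] := @segment_compact R (- (M * `|v|)) (M * `|v|) (ev @ G) _ evM.
  move=> l [_]; rewrite cluster_cvgE => -[H PH [Hl GH]]; exists l.
  apply: cvg_trans Hl => A HA.
  have [//|GA] := in_ultra_setVsetC (ev @^-1` A) UG.
  have /GH HAC : (ev @ G) (~` A) by [].
  have : H (A `&` ~` A) by exact: filterI.
  by rewrite setICr => /filter_not_empty.
have [g gP] := choice lim.
have lg : linear (g : V -> R^o).
  move=> a u v.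
  have h1 : (fun f : dual V => (f (a *: u + v) : R)) @ G --> (a * g u + g v).
    have -> : (fun f : dual V => (f (a *: u + v) : R)) =
        (fun f => a * f u + f v).
      by apply/funext => f; rewrite dualD dualZ.
    by apply: cvgD; [apply: cvgM; [exact: cvg_cst|exact: gP]|exact: gP].
  exact: (cvg_unique (@Rhausdorff R) (gP _) h1).
have bg v : `|g v| <= M * `|v|.
  have h : (fun f : dual V => `|(f v : R)|) @ G --> `|g v| by apply: cvg_norm; exact: gP.
  apply: (cvgr_to_le h); apply: filterS GM => f /= fM.
  by rewrite (le_trans (dual_norm_le f v))// ler_wpM2r.
have [g' g'g] := dual_of_bounded_linear lg bg.
by exists g' => v; rewrite g'g; exact: gP.
Qed.

Definition weak_star_cvg (R : realType) (V : normedModType R)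
    (psi : nat -> dual V) (phi : dual V) : Prop :=
  forall v, (psi n v : R) @[n --> \oo] --> (phi v : R).

Lemma far_from_one (R : realType) (V : normedModType R) (f g z : V) (e : R) :
  0 < e -> e <= `|f - g| -> e / 3 < `|f - z| \/ e / 3 < `|g - z|.
Proof.
move=> e0 efg; have := le_trans efg (ler_distD z f g); rewrite (distrC z).
move: `|f - z| `|g - z| => p q; clear efg => epq.
by have [|pe] := ltP (e / 3) p; [left|right; lra].
Qed.

(** [good W] says that [W] is sequentially weak-star open and meets [T]; the
    refinement [step] makes [W] avoid the ball of radius [e / 3] around the
    k-th term of the dense sequence [z], using one vector [v] on which a point
    of [T] in [W] witnesses this, so that the avoidance survives weak-star
    limits. *)
Lemma norm_gap_not_separable (R : realType) (V : normedModType R)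
    (T : set (dual V)) (M e : R) :
  0 < e -> T !=set0 -> (forall f, T f -> `|f| <= M) ->
  (forall f, T f -> exists2 psi, weak_star_cvg psi f &
     \forall n \near \oo, T (psi n) /\ e <= `|psi n - f|) ->
  ~ separable (dual V).
Proof.
move=> e0 T0 TM Tlim [A /countable_injP[code codeA] dA].
(* [z] enumerates [A]; indices that code no point of [A] get the value 0. *)
pose z k := xget 0 [set a | A a /\ code a = k].
have zA a : A a -> z (code a) = a.
  move=> Aa; rewrite /z; case: xgetP => [b _ [Ab]|/(_ a)[]//].
  by apply: codeA; rewrite inE.
pose good (W : set (dual V)) := (T `&` W) !=set0 /\
  forall f, W f -> forall psi, weak_star_cvg psi f ->
    \forall n \near \oo, W (psi n).
have step (p : nat * set (dual V)) : exists W : set (dual V), good p.2 ->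
    [/\ good W, W `<=` p.2 & exists2 v, `|v| <= 1 &
      forall f, W f -> e / 3 < `|(f - z p.1) v|].
  case: p => k W /=; have [gW|] := pselect (good W); last by exists W.
  case: (gW) => -[f [Tf Wf]] oW.
  have [psi psif /filterI/(_ (oW _ Wf _ psif))/filter_ex[n [[Tpsi le_e] Wpsi]]] :=
    Tlim f Tf.
  have [h [Th Wh zh]] : exists h, [/\ T h, W h & e / 3 < `|h - z k|].
    (* Two points of [T] and [W] at distance [e] cannot both be near [z k]. *)
    have [zf|zpsi] := far_from_one (z k) e0 le_e.
      by exists (psi n); exact: And3.
    by exists f; exact: And3.
  have [v v1 hv] := dual_norm_gtP zh.
  exists (W `&` [set g | e / 3 < `|(g - z k) v|]) => _; split.
  - split; first by exists h.
    move=> g [Wg gv] chi chig.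
    have lim : (fun n => `|(chi n v : R) - z k v|) @ \oo -->
        `|(g v : R) - z k v|.
      exact: (cvg_norm (cvgB (chig v) (cvg_cst (z k v : R)))).
    have near_gt : \forall n \near \oo, e / 3 < `|(chi n v : R) - z k v|.
      by apply: cvgr_gt lim _ gv.
    apply: filterS2 (oW _ Wg _ chig) near_gt.
    by move=> m Wm lt_m; split.
  - exact: subIsetl.
  - by exists v => [//|g [_ gv]]; exact: gv.
have [next nextP] := choice step.
pose fix W k := if k is j.+1 then next (j, W j) else [set: dual V].
have gW k : good (W k).
  elim: k => [|k IH]; last by case: (nextP (k, W k) IH).
  by split; [rewrite setIT|move=> *; exact: filterT].
have decW i j : (i <= j)%N -> W j `<=` W i.
  move=> /subnK <-; elim: (j - i)%N => [//|k IH].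
  by case: (nextP (k + i, W (k + i))%N (gW _)) => _ /subset_trans /(_ IH).
have [f fP] := choice (fun k => (gW k).1).
have [G [PG fG [g gP]]] : exists G, [/\ ProperFilter G, f @ \oo `<=` G &
    exists g : dual V, forall v, (fun f : dual V => f v : R) @ G --> (g v : R)].
  apply: (@bounded_weak_star_limit _ _ _ M).
  by exists 0%N => // k _; apply: TM; case: (fP k).
have GW k : G (W k).
  apply: fG; exists k => // n /= kn.
  by apply: (decW k n kn); case: (fP n).
have far k : e / 3 <= `|g - z k|.
  have [_ _ [v v1 vP]] := nextP (k, W k) (gW k).
  have h : (fun h : dual V => `|(h v : R) - z k v|) @ G --> `|(g v : R) - z k v|.
    exact: (cvg_norm (cvgB (gP v) (cvg_cst (z k v : R)))).
  apply: le_trans (dual_norm_ub (g - z k) v1).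
  apply: (cvgr_to_ge h); apply: filterS (GW k.+1) => h' /vP.
  exact: ltW.
have e3 : 0 < e / 3 by rewrite divr_gt0.
have [a [ga /zA az]] := dA (ball g (e / 3)) (ex_intro _ g (ballxx g e3))
  (ball_open _ _).
have : ball_ Num.norm g (e / 3) a by rewrite ball_normE.
by rewrite /ball_/= -az ltNge far.
Qed.

(** * Weakly spread sets *)

Definition weakly_cvg (R : realType) (E : normedModType R) (u : nat -> E)
    (x : E) : Prop :=
  forall phi : dual E, (phi (u n) : R) @[n --> \oo] --> (phi x : R).

(** No point of a weakly spread set is a point of weak-to-norm continuity, and
    [d] quantifies the failure. *)
Definition weakly_spread (R : realType) (E : normedModType R) (S : set E)
    (B d : R) : Prop :=
  [/\ S !=set0, forall x, S x -> `|x| <= B &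
      forall x, S x -> exists2 u, weakly_cvg u x &
        \forall n \near \oo, S (u n) /\ d <= `|u n - x|].

Lemma weakly_spreadZ (R : realType) (E : normedModType R) (S : set E)
    (B d t : R) : 0 < t -> weakly_spread S B d ->
  weakly_spread [set t *: x | x in S] (t * B) (t * d).
Proof.
move=> t0 [[x0 Sx0] SB Su]; split.
- by exists (t *: x0), x0.
- by move=> _ [x Sx <-]; rewrite normrZ gtr0_norm// ler_pM2l// SB.
- move=> _ [x Sx <-]; have [u ux uS] := Su x Sx.
  exists (fun n => t *: u n).
    move=> phi; rewrite dualZ.
    have -> : (fun n => (phi (t *: u n) : R)) = (fun n => t * (phi (u n) : R)).
      by apply/funext => n; rewrite dualZ.
    by apply: cvgM; [exact: cvg_cst|exact: ux].
  apply: filterS uS => n [Sun dun]; split; first by exists (u n).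
  by rewrite -scalerBr normrZ gtr0_norm// ler_pM2l.
Qed.

(** The image of the spread set has the norm gap [e] excluded by
    [norm_gap_not_separable]. *)
Lemma weakly_spread_not_separable (R : realType) (E Y : normedModType R)
    (f : E -> dual Y) (S : set E) (B d M e : R) :
  weak_to_weak_star_seq_continuous f -> weakly_spread S B d -> 0 < e ->
  (forall x, `|x| <= B -> `|f x| <= M) ->
  (forall x y, d <= `|x - y| -> e <= `|f x - f y|) ->
  ~ separable (dual Y).
Proof.
move=> fc [[x0 Sx0] SB Su] e0 fM fe.
apply: (@norm_gap_not_separable _ _ (f @` S) M e) => //.
- by exists (f x0), x0.
- by move=> _ [x Sx <-]; apply: fM; exact: SB.
- move=> _ [x Sx <-]; have [u ux uS] := Su x Sx.
  exists (f \o u).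
    have /fc : u n @[n --> \oo] --> (x : weak E).
      by apply/weak_cvgP => phi; exact: ux.
    by move=> /weak_star_cvgP fu v; exact: fu.
  apply: filterS uS => n [Sun dun]; split; first by exists (u n).
  exact: fe.
Qed.

Lemma coarse_embedding_bounded (R : realType) (E F : normedModType R)
    (f : E -> F) (B : R) : coarse_embedding f ->
  exists M, forall x, `|x| <= B -> `|f x| <= M.
Proof.
move=> [_ /(_ `|B| (normr_ge0 _)) om].
exists (fine (omega f `|B|) + `|f 0|) => x xB.
have dx : (`|f x - f 0|%:E <= omega f `|B|)%E.
  apply: ereal_sup_ubound; right; exists (x, 0) => //=.
  by rewrite subr0 (le_trans xB)// ler_norm.
have fin : omega f `|B| \is a fin_num.
  by rewrite fin_numElt om andbT (lt_le_trans _ dx)// ltNyr.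
rewrite -[X in `|X|](subrK (f 0)) (le_trans (ler_normD _ _))// lerD2r.
by rewrite -lee_fin fineK.
Qed.

Lemma coarse_embedding_expanding (R : realType) (E F : normedModType R)
    (f : E -> F) : coarse_embedding f ->
  exists2 A, 0 < A & forall d x y, A <= d -> d <= `|x - y| -> 1 <= `|f x - f y|.
Proof.
move=> [/cvgeyPge /(_ 1) [A [Ar HA]] _].
exists (`|A| + 1); first by rewrite ltr_pwDr.
move=> d x y Ad dxy; rewrite -lee_fin.
apply: (@le_trans _ _ (rho f (`|A| + 1))).
  by apply: HA; rewrite (le_lt_trans (ler_norm A))// ltrDl.
by apply: ereal_inf_lbound; exists (x, y) => //=; exact: le_trans dxy.
Qed.

(** A uniformly continuous map on a normed space is bounded on balls, since
    the segment from 0 to [x] splits into boundedly many short steps. *)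
Lemma unif_continuous_bounded (R : realType) (E F : normedModType R)
    (f : E -> F) (B : R) : unif_continuous f ->
  exists M, forall x, `|x| <= B -> `|f x| <= M.
Proof.
move=> /unif_continuousP /(_ 1 ltr01)[d d0 fd].
pose N := (Num.truncn (`|B| / d)).+1.
have NB : `|B| / d < N%:R by exact: truncnS_gt.
exists (`|f 0| + N%:R) => x xB.
suff H k : `|f ((k%:R / N%:R) *: x)| <= `|f 0| + k%:R.
  by have := H N; rewrite divff ?pnatr_eq0// scale1r.
elim: k => [|k IH]; first by rewrite mul0r scale0r addr0.
have step : `|f ((k%:R / N%:R) *: x) - f ((k.+1%:R / N%:R) *: x)| < 1.
  have : ball (f ((k%:R / N%:R) *: x)) 1 (f ((k.+1%:R / N%:R) *: x)).
    apply: (fd (_, _)) => /=; rewrite -ball_normE /= -scalerBl -mulrBl.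
    rewrite -[in X in _ - X]addn1 natrD opprD addNKr mulN1r normrZ normrN.
    rewrite ger0_norm ?invr_ge0// mulrC ltr_pdivrMr// mulrC.
    by rewrite (le_lt_trans (le_trans xB (ler_norm B)))// -ltr_pdivrMr.
  by rewrite -ball_normE.
rewrite -[f _](subKr (f ((k%:R / N%:R) *: x))) (le_trans (ler_normB _ _))//.
by rewrite (le_trans (lerD IH (ltW step)))// -addrA natr1.
Qed.

Lemma uniform_embedding_expanding (R : realType) (E F : normedModType R)
    (f : E -> F) (d : R) : 0 < d -> uniform_embedding f ->
  exists2 e, 0 < e & forall x y, d <= `|x - y| -> e <= `|f x - f y|.
Proof.
move=> d0 [fi _ [g fg /unif_continuousP /(_ d d0)[e e0 ge]]].
exists e => // x y; apply: contraTT; rewrite -!ltNge => fxy.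
have rx z : range f (f z) by exists z.
pose mk z : range f := SigSub (mem_set (rx z)).
have gK z : g (mk z) = z by apply: fi; rewrite fg.
have : ball (g (mk x)) d (g (mk y)).
  apply: (ge (mk x, mk y)) => /=.
  have bxy : ball (f x) e (f y) by rewrite -ball_normE.
  exact: bxy.
by rewrite !gK -ball_normE.
Qed.

(** Scaling makes the spread of [S] reach the range where a coarse embedding
    separates points; a uniform embedding separates points at every scale. *)
Lemma weakly_spread_no_embedding (R : realType) (E Y : normedModType R)
    (S : set E) (B d : R) : 0 < d -> weakly_spread S B d ->
  separable (dual Y) ->
  (~ exists f : E -> dual Y,
       weak_to_weak_star_seq_continuous f /\ coarse_embedding f) /\
  (~ exists f : E -> dual Y,
       weak_to_weak_star_seq_continuous f /\ uniform_embedding f).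
Proof.
move=> d0 SS sepY; split=> -[f [fc fe]]; move: sepY.
- have [A A0 fA] := coarse_embedding_expanding fe.
  have t0 : 0 < A / d by rewrite divr_gt0.
  have [M fM] := coarse_embedding_bounded (A / d * B) fe.
  apply: (weakly_spread_not_separable fc (weakly_spreadZ t0 SS) ltr01 fM).
  by move=> x y; apply: fA; rewrite divfK// gt_eqF.
- have [e e0 fd] := uniform_embedding_expanding d0 fe.
  have [_ fu _] := fe; have [M fM] := unif_continuous_bounded B fu.
  exact: (weakly_spread_not_separable fc SS e0 fM fd).
Qed.

(** * Upper 2-estimates *)

(** The scalars [phi (g n)], used as coefficients, bound their own partial
    square sums. *)
Lemma weakly_null_of_2_estimate (R : realType) (E : normedModType R)
    (g : nat -> E) (K : R) :
  (forall N (a : nat -> R),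
     `|\sum_(n < N) a n *: g n| ^+ 2 <= K * \sum_(n < N) a n ^+ 2) ->
  weakly_cvg g 0.
Proof.
move=> gK phi; rewrite dual0.
pose b n : R := phi (g n).
have bK N : \sum_(n < N) b n ^+ 2 <= `|phi| ^+ 2 * K.
  set s := \sum_(_ < _) _.
  have s_ge0 : 0 <= s by apply: sumr_ge0 => i _; exact: sqr_ge0.
  have [->|s_neq0] := eqVneq s 0.
    have := gK 1%N (fun=> 1); rewrite !big_ord1 expr1n mulr1 => /(le_trans _) K0.
    by rewrite mulr_ge0 ?sqr_ge0// K0// sqr_ge0.
  have s_gt0 : 0 < s by rewrite lt_def s_neq0.
  have sE : s = phi (\sum_(n < N) b n *: g n).
    rewrite (@dual_sum _ _ phi N (fun n => b n *: g n)).
    by apply: eq_bigr => n _; rewrite dualZ expr2.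
  (* [s ^ 2 = phi (...) ^ 2 <= |phi| ^ 2 * (K * s)], where one factor [s]
     cancels. *)
  rewrite -(ler_pM2r s_gt0) -mulrA.
  apply: le_trans (ler_wpM2l (sqr_ge0 _) (gK N b)).
  rewrite -exprMn -expr2 -[s]gtr0_norm// {1}sE.
  by rewrite lerXn2r ?nnegrE ?mulr_ge0// dual_norm_le.
have b2 : (fun n => b n ^+ 2) @ \oo --> 0.
  apply: cvg_series_cvg_0; apply: nondecreasing_is_cvgn.
    apply/nondecreasing_seqP => n.
    by rewrite /series/= big_nat_recr//= lerDl sqr_ge0.
  by exists (`|phi| ^+ 2 * K) => _ [N _ <-]; rewrite /series/= big_mkord.
apply/cvgr0Pnorm_lt => e e0.
have e20 : 0 < e ^+ 2 by rewrite exprn_gt0.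
move/cvgr0Pnorm_lt: b2 => /(_ _ e20); apply: filterS => n.
by rewrite normrX ltr_pXn2r// nnegrE ltW.
Qed.

Lemma weakly_cvg_shift (R : realType) (E : normedModType R) (x : E)
    (g : nat -> E) : weakly_cvg g 0 -> weakly_cvg (fun n => x + g n) x.
Proof.
move=> g0 phi.
have -> : (fun n => (phi (x + g n) : R)) = (fun n => (phi x : R) + phi (g n)).
  by apply/funext => n; rewrite dualD.
rewrite -[X in _ --> X]addr0; apply: cvgD; first exact: cvg_cst.
by have := g0 phi; rewrite dual0.
Qed.

(** * Finite indicators in c0 *)

Lemma finite_support_c0 (R : realType) (u : nat -> R^o) N :
  (forall n, (N <= n)%N -> u n = 0) -> u \in @c0_pred R.
Proof.
move=> uN; rewrite inE /=; apply: (@cvg_trans _ ((fun=> 0 : R^o) @ \oo)).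
  by apply: near_eq_cvg; exists N => // n /= /uN.
exact: cvg_cst.
Qed.

Lemma c0_unit_subproof (R : realType) (n : nat) :
  (fun k => (k == n)%:R : R^o) \in @c0_pred R.
Proof. by apply: (@finite_support_c0 _ _ n.+1) => k /gtn_eqF ->. Qed.

Definition c0_unit (R : realType) n : c0 R := C0 (c0_unit_subproof R n).

Lemma c0_norm_le (R : realType) (u : c0 R) (M : R) :
  (forall n, `|u n| <= M) -> `|u| <= M.
Proof.
move=> uM; apply: ge_sup; first by case: (c0_has_sup u).
by move=> _ [n _ <-].
Qed.

Lemma c0D (R : realType) (u v : c0 R) k : (u + v) k = u k + v k.
Proof. by []. Qed.

Lemma c0_unit_sum (R : realType) N (a : nat -> R) k :
  (\sum_(n < N) a n *: c0_unit R n) k = if (k < N)%N then a k else 0 :> R.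
Proof.
elim: N => [|N IH]; first by rewrite big_ord0.
rewrite big_ord_recr c0D IH.
have -> : (a N *: c0_unit R N) k = a N * (k == N)%:R by [].
rewrite [(k < N.+1)%N]ltnS [(k <= N)%N]leq_eqVlt; case: eqVneq => [->|_].
  by rewrite /= ltnn mulr1 add0r.
by rewrite /= mulr0 addr0.
Qed.

(** In [c0] a linear combination of unit vectors has norm [max |a n|], at most
    the square root of the sum of the [a n ^ 2]. *)
Lemma c0_unit_weakly_null (R : realType) : weakly_cvg (c0_unit R) 0.
Proof.
apply: (@weakly_null_of_2_estimate _ _ _ 1) => N a; rewrite mul1r.
set Q := \sum_(n < N) a n ^+ 2.
have Q0 : 0 <= Q by apply: sumr_ge0 => i _; exact: sqr_ge0.
rewrite -[leRHS]sqr_sqrtr// lerXn2r ?nnegrE ?sqrtr_ge0//.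
apply: c0_norm_le => k; rewrite c0_unit_sum; case: ifP => kN; last first.
  by rewrite normr0 sqrtr_ge0.
rewrite -sqrtr_sqr ler_wsqrtr// /Q (bigD1 (Ordinal kN))//= lerDl.
by apply: sumr_ge0 => i _; exact: sqr_ge0.
Qed.

(** Adding a unit vector beyond the support of an indicator yields an
    indicator again. *)
Lemma c0_weakly_spread (R : realType) :
  weakly_spread [set u : c0 R | (exists N, forall n, (N <= n)%N -> u n = 0) /\
    forall n, u n = 0 \/ u n = 1] 1 1.
Proof.
split.
- by exists 0; split; [exists 0%N|left].
- move=> u [_ u01]; apply: c0_norm_le => n.
  by have [->|->] := u01 n; rewrite ?normr0 ?normr1.
- move=> u [[N uN] u01]; exists (fun n => u + c0_unit R n).
    exact/weakly_cvg_shift/c0_unit_weakly_null.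
  exists N => // n /= Nn.
  have uk k : (u + c0_unit R n) k = u k + (k == n)%:R by [].
  split; last first.
    rewrite [u + _]addrC addrK; apply: le_trans (c0_norm_ub (c0_unit R n) n).
    by rewrite /= eqxx normr1.
  split.
    exists n.+1 => k nk; rewrite [LHS]uk gtn_eqF// addr0 uN//.
    by rewrite (leq_trans Nn)// ltnW.
  move=> k; suff : u k + (k == n)%:R = 0 \/ u k + (k == n)%:R = 1 by [].
  case: eqVneq => [->|_]; last by rewrite addr0.
  by rewrite uN// add0r; right.
Qed.

(** * Bounded functions in L1 *)

Section BoundedFunctions.
Context d (T : measurableType d) (R : realType).
Variable mu : {measure set T -> \bar R}.
Hypothesis mu1 : mu setT = 1%E.

Definition bounded_mfun (f : T -> R) : Prop :=
  measurable_fun [set: T] f /\ exists M, forall x, `|f x| <= M.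

Lemma bounded_mfun_cst c : bounded_mfun (fun=> c).
Proof. by split; [exact: measurable_cst|exists `|c|]. Qed.

Lemma bounded_mfunD f g : bounded_mfun f -> bounded_mfun g ->
  bounded_mfun (fun x => f x + g x).
Proof.
move=> [mf [M fM]] [mg [N gN]]; split; first exact: measurable_funD.
exists (M + N) => x; rewrite (le_trans (ler_normD _ _))//.
by rewrite lerD.
Qed.

Lemma bounded_mfunM f g : bounded_mfun f -> bounded_mfun g ->
  bounded_mfun (fun x => f x * g x).
Proof.
move=> [mf [M fM]] [mg [N gN]]; split; first exact: measurable_funM.
by exists (M * N) => x; rewrite normrM ler_pM.
Qed.

Lemma bounded_mfunZ a f : bounded_mfun f -> bounded_mfun (fun x => a * f x).
Proof. by move=> bf; apply: bounded_mfunM => //; exact: bounded_mfun_cst. Qed.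

Lemma bounded_mfun_norm f : bounded_mfun f -> bounded_mfun (fun x => `|f x|).
Proof.
move=> [mf [M fM]]; split; first exact: measurableT_comp.
by exists M => x; rewrite normr_id.
Qed.

Lemma bounded_mfun_sum N (f : nat -> T -> R) :
  (forall n, bounded_mfun (f n)) -> bounded_mfun (fun x => \sum_(n < N) f n x).
Proof.
move=> bf; elim: N => [|N IH].
  by under eq_fun do rewrite big_ord0; exact: bounded_mfun_cst.
by under eq_fun do rewrite big_ord_recr; exact: bounded_mfunD.
Qed.

Lemma bounded_mfun_integrable f : bounded_mfun f ->
  mu.-integrable setT (EFin \o f).
Proof.
move=> [mf [M fM]]; apply: measurable_bounded_integrable => //.
  by rewrite mu1 ltry.
exists M; split; first exact: num_real.
by move=> N MN x _; exact: le_trans (fM x) (ltW MN).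
Qed.

Lemma meanD f g : bounded_mfun f -> bounded_mfun g ->
  \int[mu]_x (f x + g x) = \int[mu]_x f x + \int[mu]_x g x.
Proof. by move=> bf bg; apply: RintegralD => //; exact: bounded_mfun_integrable. Qed.

Lemma meanZ a f : bounded_mfun f ->
  \int[mu]_x (a * f x) = a * \int[mu]_x f x.
Proof. by move=> bf; apply: RintegralZl => //; exact: bounded_mfun_integrable. Qed.

Lemma mean_sum N (f : nat -> T -> R) : (forall n, bounded_mfun (f n)) ->
  \int[mu]_x (\sum_(n < N) f n x) = \sum_(n < N) \int[mu]_x f n x.
Proof.
move=> bf; elim: N => [|N IH].
  rewrite big_ord0; under eq_Rintegral do rewrite big_ord0.
  by rewrite Rintegral_cst// mul0r.
rewrite big_ord_recr /= -IH -(meanD (bounded_mfun_sum N bf) (bf N)).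
by under eq_Rintegral do rewrite big_ord_recr.
Qed.

Lemma le_mean f g : bounded_mfun f -> bounded_mfun g ->
  (forall x, f x <= g x) -> \int[mu]_x f x <= \int[mu]_x g x.
Proof.
move=> bf bg fg; apply: le_Rintegral => //; exact: bounded_mfun_integrable.
Qed.

Lemma mean_cst c : \int[mu]_x c = c.
Proof. by rewrite Rintegral_cst// mu1 mulr1. Qed.

(** Jensen's inequality for the square, from
    [2 * s * |f| <= f ^ 2 + s ^ 2] at [s] the mean of [|f|]. *)
Lemma sqr_mean_norm_le f : bounded_mfun f ->
  (\int[mu]_x `|f x|) ^+ 2 <= \int[mu]_x (f x ^+ 2).
Proof.
move=> bf; set s := \int[mu]_x _.
have bf2 : bounded_mfun (fun x => f x ^+ 2) by exact: bounded_mfunM.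
have : \int[mu]_x (2 * s * `|f x|) <= \int[mu]_x (f x ^+ 2 + s ^+ 2).
  apply: le_mean.
  - exact/bounded_mfunZ/bounded_mfun_norm.
  - by apply: bounded_mfunD => //; exact: bounded_mfun_cst.
  - move=> x; rewrite -[f x ^+ 2]real_normK ?num_real// -subr_ge0.
    have -> : `|f x| ^+ 2 + s ^+ 2 - 2 * s * `|f x| = (`|f x| - s) ^+ 2 by ring.
    exact: sqr_ge0.
rewrite meanZ; last exact: bounded_mfun_norm.
rewrite meanD//; last exact: bounded_mfun_cst.
rewrite mean_cst -/s; move: s (\int[mu]_x _) => s' q; lra.
Qed.

Let L1 : normedModType R := LspaceType1 mu.

Lemma bounded_mfun_Lfun f : bounded_mfun f -> f \in Lfun mu 1.
Proof. by move=> bf; apply/Lfun1_integrable; exact: bounded_mfun_integrable. Qed.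

(** The junk value 0 outside of integrable functions makes this a total
    function, so that sums and products need no bundling. *)
Definition L1_cls (f : T -> R) : L1 :=
  if pselect (f \in Lfun mu 1) is left fL1
  then L1_class (Lfun_Sub (@lexx _ _ 1%E) fL1) else 0.

Lemma L1_clsE f (fL1 : f \in Lfun mu 1) :
  L1_cls f = L1_class (Lfun_Sub (@lexx _ _ 1%E) fL1).
Proof.
rewrite /L1_cls; case: pselect => // fL1'; congr L1_class.
by rewrite (Prop_irrelevance fL1 fL1').
Qed.

Lemma L1_clsD f g : bounded_mfun f -> bounded_mfun g ->
  L1_cls (fun x => f x + g x) = L1_cls f + L1_cls g.
Proof.
move=> bf bg.
rewrite (L1_clsE (bounded_mfun_Lfun bf)) (L1_clsE (bounded_mfun_Lfun bg)).
rewrite (L1_clsE (bounded_mfun_Lfun (bounded_mfunD bf bg))).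
rewrite [RHS]L1_addE; apply: L1_class_eq; exact: aeW.
Qed.

Lemma L1_clsZ a f : bounded_mfun f ->
  L1_cls (fun x => a * f x) = a *: L1_cls f.
Proof.
move=> bf; rewrite (L1_clsE (bounded_mfun_Lfun bf)).
rewrite (L1_clsE (bounded_mfun_Lfun (bounded_mfunZ a bf))).
rewrite [RHS]L1_scaleE; apply: L1_class_eq; exact: aeW.
Qed.

Lemma L1_cls_sum N (f : nat -> T -> R) : (forall n, bounded_mfun (f n)) ->
  L1_cls (fun x => \sum_(n < N) f n x) = \sum_(n < N) L1_cls (f n).
Proof.
move=> bf; elim: N => [|N IH].
  rewrite big_ord0; under eq_fun do rewrite big_ord0.
  have := L1_clsZ 0 (bounded_mfun_cst 0); rewrite scale0r => <-.
  by congr L1_cls; apply/funext => x; rewrite mul0r.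
rewrite big_ord_recr /= -IH -(L1_clsD (bounded_mfun_sum N bf) (bf N)).
by congr L1_cls; apply/funext => x; rewrite big_ord_recr.
Qed.

Lemma L1_cls_norm f : bounded_mfun f -> `|L1_cls f| = \int[mu]_x `|f x|.
Proof.
move=> bf; rewrite (L1_clsE (bounded_mfun_Lfun bf)).
by rewrite [LHS]L1_normE Lnorm1.
Qed.

Lemma L1_repr_integrable (u : L1) :
  mu.-integrable setT (EFin \o (L1_repr u : T -> R)).
Proof. by apply/Lfun1_integrable; exact: LfunP. Qed.

Lemma mean_ae_eq (f g : T -> R) : mu.-integrable setT (EFin \o f) ->
  mu.-integrable setT (EFin \o g) -> f = g %[ae mu] ->
  \int[mu]_x f x = \int[mu]_x g x.
Proof.
move=> /integrableP[mf _] /integrableP[mg _] fg.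
congr fine; apply: ae_eq_integral => //.
by apply: filterS fg => x /= fgx xT; rewrite fgx.
Qed.

(** Pairing with this functional turns weak nullity into convergence of
    integrals. *)
Lemma L1_mean_functional :
  {phi : dual L1 | forall f, bounded_mfun f -> phi (L1_cls f) = \int[mu]_x f x}.
Proof.
pose I (u : L1) : R^o := \int[mu]_x (L1_repr u x).
have linI : linear I.
  move=> a u v; rewrite /I.
  have iau : mu.-integrable setT (EFin \o (fun x => a * L1_repr u x)).
    by apply/Lfun1_integrable; exact: (LfunP (a *: L1_repr u)).
  have -> : a *: (\int[mu]_x L1_repr u x) + (\int[mu]_x L1_repr v x) =
      \int[mu]_x (a * L1_repr u x + L1_repr v x) :> R.
    rewrite RintegralD//; last exact: L1_repr_integrable.
    by rewrite RintegralZl//; exact: L1_repr_integrable.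
  apply: mean_ae_eq; first exact: L1_repr_integrable.
    apply/Lfun1_integrable.
    exact: (LfunP (a *: L1_repr u + L1_repr v)).
  have -> : a *: u + v = L1_class (a *: L1_repr u + L1_repr v).
    by rewrite -L1_addE -L1_scaleE !L1_reprK.
  exact: L1_repr_class.
have bI u : `|I u| <= 1 * `|u|.
  rewrite mul1r (le_trans (le_normr_Rintegral _ (L1_repr_integrable u)))//.
  by rewrite [leRHS]/(L1_norm u) /L1_norm Lnorm1.
have [phi phiE] := dual_of_bounded_linear linI bI.
exists phi => f bf; rewrite phiE (L1_clsE (bounded_mfun_Lfun bf)).
apply: mean_ae_eq; first exact: L1_repr_integrable.
  exact: bounded_mfun_integrable.
exact: L1_repr_class.
Qed.

(** Multiplying an orthogonal system by a bounded function keeps Bessel's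
    upper 2-estimate in the norm of L2, hence in the smaller one of L1; so no
    description of the dual of L1 is involved. *)
Lemma orthogonal_weakly_null (e : nat -> T -> R) (w : T -> R) :
  (forall n, bounded_mfun (e n)) -> (forall n x, `|e n x| <= 1) ->
  (forall m n, m <> n -> \int[mu]_x (e m x * e n x) = 0) ->
  bounded_mfun w -> weakly_cvg (fun n => L1_cls (fun x => w x * e n x)) 0.
Proof.
move=> be e1 orth bw; have [mw [M wM]] := bw.
apply: (@weakly_null_of_2_estimate _ _ _ (M ^+ 2)) => N a.
pose p x := \sum_(n < N) a n * e n x.
have bp : bounded_mfun p.
  by apply: (bounded_mfun_sum _ (fun n => bounded_mfunZ (a n) (be n))).
have bwe n : bounded_mfun (fun x => w x * e n x) by exact: bounded_mfunM.
have -> : \sum_(n < N) a n *: L1_cls (fun x => w x * e n x) =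
    L1_cls (fun x => w x * p x).
  under eq_bigr do rewrite -L1_clsZ//.
  rewrite -(L1_cls_sum N (fun n => bounded_mfunZ (a n) (bwe n))).
  congr L1_cls; apply/funext => x; rewrite mulr_sumr.
  by apply: eq_bigr => n _; rewrite mulrCA.
have bwp : bounded_mfun (fun x => w x * p x) by exact: bounded_mfunM.
rewrite L1_cls_norm// (le_trans (sqr_mean_norm_le bwp))//.
have bp2 : bounded_mfun (fun x => p x ^+ 2) by exact: bounded_mfunM.
apply: (@le_trans _ _ (\int[mu]_x (M ^+ 2 * p x ^+ 2))).
  apply: le_mean; [exact: bounded_mfunM|exact: bounded_mfunZ|].
  move=> x; rewrite exprMn ler_wpM2r ?sqr_ge0//.
  by rewrite -[w x ^+ 2]real_normK ?num_real// lerXn2r ?nnegrE// (le_trans _ (wM x)).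
rewrite meanZ// ler_wpM2l ?sqr_ge0//.
have bae n : bounded_mfun (fun x => a n * e n x) by exact: bounded_mfunZ.
have -> : \int[mu]_x (p x ^+ 2) =
    \sum_(m < N) \sum_(n < N) a m * a n * \int[mu]_x (e m x * e n x).
  transitivity (\int[mu]_x (\sum_(m < N) a m * e m x * p x)).
    by apply: eq_Rintegral => x _; rewrite expr2 {1}/p mulr_suml.
  rewrite (mean_sum N (fun m => bounded_mfunM (bae m) bp)).
  apply: eq_bigr => m _.
  transitivity (\int[mu]_x (\sum_(n < N) a m * a n * (e m x * e n x))).
    apply: eq_Rintegral => x _; rewrite mulr_sumr; apply: eq_bigr => n _.
    by rewrite mulrACA.
  rewrite (mean_sum N (fun n => bounded_mfunZ (a m * a n)
    (bounded_mfunM (be m) (be n)))).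
  by apply: eq_bigr => n _; rewrite meanZ//; exact: bounded_mfunM.
apply: ler_sum => m _; rewrite (bigD1 m)//= big1 ?addr0.
  rewrite -expr2 ler_piMr ?sqr_ge0// -[leRHS](mean_cst 1).
  apply: le_mean; [exact: bounded_mfunM|exact: bounded_mfun_cst|].
  move=> x; rewrite -expr2 -[_ ^+ 2]real_normK ?num_real//.
  by rewrite expr_le1.
move=> n nm; rewrite orth ?mulr0// => mn.
by move: nm; rewrite -val_eqE /= mn eqxx.
Qed.

End BoundedFunctions.

(** * Cosines on the unit interval *)

Section Cosines.
Variable R : realType.
Local Notation mu := (lebesgue01 R).

Lemma lebesgue01T : mu setT = 1%E.
Proof.
rewrite /lebesgue01 /= /mrestr setTI lebesgue_measure_itv /= lte_fin ltr01.
by rewrite sube0.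
Qed.

(** The complement of the unit interval is negligible for [mu], and [mu] agrees
    with Lebesgue measure on the subsets of the interval. *)
Lemma mean_lebesgue01 (f : R -> R) :
  @bounded_mfun _ (measurableTypeR R) R f ->
  \int[mu]_x f x = fine (\int[@lebesgue_measure R]_(x in `[0%R, 1%R]) (f x)%:E)%E.
Proof.
move=> bf; congr fine.
have mI : measurable (`[0%R, 1%R]%classic : set (measurableTypeR R)).
  exact: measurable_itv.
rewrite (@negligible_integral _ _ _ mu setT (~` `[0%R, 1%R])).
- rewrite setTD setCK; apply: eq_measure_integral => A mA AI.
  by rewrite /lebesgue01 /= /mrestr setIidl.
- exact: measurableC.
- exact: measurableT.
- exact: (bounded_mfun_integrable lebesgue01T bf).
- by rewrite /lebesgue01 /= /mrestr setICl measure0.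
Qed.

Definition cosine (n : nat) (x : R) : R := cos (pi *+ 2 * n%:R * x).

Lemma cosine_le1 n x : `|cosine n x| <= 1.
Proof. by rewrite ler_norml cos_geN1 cos_le1. Qed.

Lemma continuous_cosine n : continuous (cosine n).
Proof.
move=> x; apply: continuous_comp; last exact: continuous_cos.
exact: mulrl_continuous.
Qed.

Lemma cosine_bounded_mfun n : @bounded_mfun _ (measurableTypeR R) R (cosine n).
Proof.
split; last by exists 1; exact: cosine_le1.
by apply: continuous_measurable_fun; exact: continuous_cosine.
Qed.

Lemma sin_2pi_natmul n : sin (pi *+ 2 * n%:R) = 0 :> R.
Proof.
elim: n => [|n IH]; first by rewrite mulr0 sin0.
by rewrite -natr1 mulrDr mulr1 (sinD2pi _).
Qed.

Lemma mean_cosine n : (0 < n)%N -> \int[mu]_x cosine n x = 0.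
Proof.
move=> n0; rewrite mean_lebesgue01; last exact: cosine_bounded_mfun.
pose c : R := pi *+ 2 * n%:R.
have c0 : c != 0.
  by rewrite mulf_neq0// ?pnatr_eq0 -?lt0n// mulrn_eq0/= gt_eqF// pi_gt0.
pose F x : R := c^-1 * sin (c * x).
have dF (x : R) : is_derive x (1 : R) F (cosine n x).
  have dc : is_derive x (1 : R) (c *: @id R) (c *: 1) by exact: is_deriveZ.
  have dsin := is_derive1_comp (is_derive_sin (c * x)) dc.
  have -> : cosine n x = c^-1 *: (cos (c * x) * (c *: 1)).
    by rewrite /cosine -/c /GRing.scale/=; field.
  exact: (is_deriveZ c^-1 dsin).
have cF : continuous F.
  by move=> x; apply: differentiable_continuous; apply/derivable1_diffP.
rewrite (@continuous_FTC2 _ _ F)//.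
- by rewrite /F mulr0 mulr1 sin_2pi_natmul sin0 mulr0 subee.
- by apply: continuous_subspaceT; exact: continuous_cosine.
- split => [x _||].
  + by case: (dF x).
  + exact/cvg_at_right_filter/cF.
  + exact/cvg_at_left_filter/cF.
- by move=> x _; rewrite derive1E; case: (dF x).
Qed.

Lemma cosine_mul m n x : (m <= n)%N ->
  cosine m x * cosine n x = 2^-1 * (cosine (n - m) x + cosine (n + m) x).
Proof.
move=> mn; rewrite /cosine natrB// natrD.
have -> : pi *+ 2 * (n%:R - m%:R) * x =
  pi *+ 2 * n%:R * x - pi *+ 2 * m%:R * x :> R by ring.
have -> : pi *+ 2 * (n%:R + m%:R) * x =
  pi *+ 2 * n%:R * x + pi *+ 2 * m%:R * x :> R by ring.
by rewrite cosB cosD; field.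
Qed.

Lemma cosine_orthogonal m n : m <> n ->
  \int[mu]_x (cosine m.+1 x * cosine n.+1 x) = 0.
Proof.
wlog mn : m n / (m < n)%N.
  move=> H mn; have [||//] := ltngtP m n; first by move/H; exact.
  move=> nm; under eq_Rintegral do rewrite mulrC.
  by apply: H => // nm'; exact: mn.
move=> _; under eq_Rintegral do rewrite cosine_mul ?ltnS 1?ltnW//.
rewrite (meanZ lebesgue01T) ?(meanD lebesgue01T) ?mean_cosine ?addr0 ?mulr0//.
- by rewrite subSS subn_gt0.
- exact: cosine_bounded_mfun.
- exact: cosine_bounded_mfun.
- by apply: bounded_mfunD; exact: cosine_bounded_mfun.
Qed.

Lemma cosine_sqr n x :
  cosine n.+1 x ^+ 2 = 2^-1 * (1 + cosine n.*2.+2 x).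
Proof.
rewrite expr2 cosine_mul// subnn addSn addnS addnn.
by rewrite {1}/cosine mulr0 mul0r cos0.
Qed.

End Cosines.

(** * A weakly spread set in L1 *)

(** The bounds on the mass are strict so that multiplication by
    [1 + cosine n.+1] preserves them for large [n]: it changes the mass by a
    Fourier coefficient, which tends to 0. *)
Lemma L1_weakly_spread (R : realType) :
  @weakly_spread R (L1_01 R)
    [set u | exists w : R -> R,
       [/\ @bounded_mfun _ (measurableTypeR R) R w, forall x, 0 <= w x,
           1 < \int[lebesgue01 R]_x w x < 3 & u = L1_cls (lebesgue01 R) w]]
    3 4^-1.
Proof.
have mu1 := lebesgue01T R.
split.
- exists (L1_cls (lebesgue01 R) (fun=> 2)), (fun=> 2); split => //.
    exact: bounded_mfun_cst.
  by rewrite (mean_cst mu1); apply/andP; split; lra.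
- move=> _ [w [bw w0 /andP[_ w3] ->]]; rewrite (L1_cls_norm mu1)//.
  under eq_Rintegral do rewrite ger0_norm//.
  exact: ltW.
- move=> _ [w [bw w0 /andP[w1 w3] ->]].
  have be n := cosine_bounded_mfun R n.
  have bwe n : @bounded_mfun _ (measurableTypeR R) R (fun x => w x * cosine n.+1 x).
    by apply: bounded_mfunM.
  pose g n := L1_cls (lebesgue01 R) (fun x => w x * cosine n.+1 x).
  have g0 : weakly_cvg g 0.
    apply: (orthogonal_weakly_null mu1) => //.
      by move=> n x; exact: cosine_le1.
    exact: cosine_orthogonal.
  exists (fun n => L1_cls (lebesgue01 R) w + g n).
    exact: weakly_cvg_shift.
  have [phi phiE] := L1_mean_functional mu1.
  have c0 : (fun n => \int[lebesgue01 R]_x (w x * cosine n.+1 x)) @ \oo --> 0.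
    have := g0 phi; rewrite dual0.
    have -> // : (fun n => phi (g n) : R) =
      (fun n => \int[lebesgue01 R]_x (w x * cosine n.+1 x)).
    by apply/funext => n; rewrite phiE.
  set I := \int[lebesgue01 R]_x w x in w1 w3.
  (* [2^-1] is for the norm estimate below: half of the sum of the mass, above
     1, and of a Fourier coefficient, above [- 2^-1], exceeds [4^-1]. *)
  pose e := Num.min (2^-1) (Num.min (I - 1) (3 - I)).
  have e0 : 0 < e by rewrite !lt_min invr_gt0 ltr0n !subr_gt0 w1.
  have [N _ small] : \forall n \near \oo,
      `|\int[lebesgue01 R]_x (w x * cosine n.+1 x)| < e.
    by move/cvgr0Pnorm_lt: c0; exact.
  exists N => // n /= Nn; split.
    exists (fun x => w x + w x * cosine n.+1 x); split.
    + exact: bounded_mfunD.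
    + move=> x; rewrite -[X in X + _]mulr1 -mulrDr mulr_ge0//.
      by rewrite -lerBlDl sub0r cos_geN1.
    + rewrite (meanD mu1)// -/I.
      have := small n Nn; rewrite !lt_min ltr_norml => /and3P[/andP[]].
      by rewrite !ltr_norml; lra.
    + by rewrite (L1_clsD mu1).
  rewrite [_ + g n]addrC addrK (L1_cls_norm mu1)//.
  (* [|c| >= c ^ 2] for a cosine [c], and [c ^ 2] is the mean of 1 and of the
     cosine of doubled frequency. *)
  apply: (@le_trans _ _ (\int[lebesgue01 R]_x
      (2^-1 * (w x + w x * cosine n.*2.+2 x)))).
    rewrite (meanZ mu1) ?(meanD mu1)//; last exact: bounded_mfunD.
    have := small n.*2.+1; rewrite -/I /=.
    have le_n : (N <= n.*2.+1)%N.
      by rewrite (leq_trans Nn)// -addnn -addnS leq_addr.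
    move=> /(_ le_n); rewrite !lt_min ltr_norml => /andP[/andP[]].
    by move: w1; clear; lra.
  apply: (le_mean mu1).
  - by apply: bounded_mfunZ; exact: bounded_mfunD.
  - exact: bounded_mfun_norm.
  - move=> x; have -> : 2^-1 * (w x + w x * cosine n.*2.+2 x) =
        w x * cosine n.+1 x ^+ 2 by rewrite cosine_sqr; ring.
    rewrite normrM (ger0_norm (w0 x)) ler_wpM2l//.
    rewrite -[_ ^+ 2]real_normK ?num_real// expr2 ler_piMl//.
    exact: cosine_le1.
Qed.

Theorem theorem7p4 (R : realType) (E : normedModType R)
    (Y : completeNormedModType R) :
  E = c0 R :> normedModType R \/ E = L1_01 R ->
  separable (dual Y) ->
  (~ exists f : E -> dual Y,
       weak_to_weak_star_seq_continuous f /\ coarse_embedding f) /\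
  (~ exists f : E -> dual Y,
       weak_to_weak_star_seq_continuous f /\ uniform_embedding f).
Proof.
move=> [->|->].
  exact: (weakly_spread_no_embedding ltr01 (c0_weakly_spread R)).
apply: (weakly_spread_no_embedding _ (L1_weakly_spread R)).
by rewrite invr_gt0.
Qed.
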